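(* Let $g,h\ge 1$, let $m=p_1\cdots p_g$ be a product of $g$ distinct primes, and let $n=q_1\cdots q_h$ be a product of $h$ distinct primes such that each $q_j$ divides $p_i-1$ for every $i$. Let $b$ be an integer having multiplicative order $n$ modulo $p_i$ for every $i=1,\dots,g$. On the set $G=\mathbb{Z}_m\times\mathbb{Z}_n$ let $+$ be componentwise addition, so $(G,+)\cong\mathbb{Z}_{mn}$, and let $(r,s)\cdot(r',s')=(r+b^sr',\,s+s')$, so $(G,\cdot)=\mathbb{Z}_m\rtimes_b\mathbb{Z}_n$. Then $$GC((G,+),(G,\cdot))=\frac{|\{+\text{-stable subgroups of }(G,\cdot)\}|}{|\{\text{subgroups of }(G,+)\}|}=\frac{2^h+2^g-1}{2^{h+g}}$$ and $$GC((G,\cdot),(G,+))=\frac{|\{\cdot\text{-stable subgroups of }(G,+)\}|}{|\{\text{subgroups of }(G,\cdot)\}|}=\frac{2^{h+g}}{2^g+(2^h-1)\sigma(m)}\le 2\left(\frac23\right)^g,$$ where $\sigma(m)=\prod_{i=1}^g(1+p_i)$ is the sum of the divisors of $m$. In particular, when $n=2$ and $m$ is odd and squarefree with $g$ prime factors (so that $(G,\cdot)\cong D_m$, the dihedral group of order $2m$, and $(G,+)\cong\mathbb{Z}_{2m}$), one has $$GC(\mathbb{Z}_{2m},D_m)=\frac{2^g+1}{2^{g+1}}>\frac12\quad\text{and}\quad GC(D_m,\mathbb{Z}_{2m})\le 2\left(\frac23\right)^g,$$ so the second ratio tends to $0$ as $g\to\infty$.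
   Context: $\mathbb{Z}_k$ denotes the integers modulo $k$. A skew brace $(G,\circ,\star)$ is a finite set $G$ with two group operations $\circ$ and $\star$ such that $a\circ(b\star c)=(a\circ b)\star a^{-1}\star(a\circ c)$ for all $a,b,c\in G$, where $a^{-1}$ is the inverse of $a$ in $(G,\star)$ (the additive group is written last). A bi-skew brace is a set with two group operations that is a skew brace with either group acting as the additive group; for the operations in the claim, $(G,+,\cdot)$ is a bi-skew brace. Given a skew brace $(G,\circ,\star)$, let $\lambda_\circ(g)(x)=g\circ x$ and $\lambda_\star(g)(x)=g\star x$ in $\mathrm{Perm}(G)$. A subgroup $G'$ of $(G,\star)$ is $\circ$-stable if $\lambda_\star(G')$ is closed under conjugation in $\mathrm{Perm}(G)$ by $\lambda_\circ(G)$; equivalently, $(g\circ g')\star g^{-1}\in G'$ for all $g\in G$, $g'\in G'$ (inverse in $(G,\star)$). The Galois correspondence ratio $GC((G,\circ),(G,\star))$ is the proportion of intermediate fields of a Galois extension $L/K$ with Galois group $(G,\circ)$ that lie in the image of the Galois correspondence for the Hopf Galois structure of type $(G,\star)$ on $L/K$ corresponding to the skew brace $(G,\circ,\star)$; it equals $$GC((G,\circ),(G,\star))=\frac{|\{\circ\text{-stable subgroups of }(G,\star)\}|}{|\{\text{subgroups of }(G,\circ)\}|}.$$ So $GC((G,+),(G,\cdot))$ uses the skew brace $(G,+,\cdot)$ and $GC((G,\cdot),(G,+))$ uses the skew brace $(G,\cdot,+)$. $GC(\mathbb{Z}_{2m},D_m)$ and $GC(D_m,\mathbb{Z}_{2m})$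 denote these two ratios for the bi-skew brace with $n=2$. *)

(* Defs.v *)
From HB Require Import structures.
From mathcomp Require Import all_boot all_order all_algebra all_fingroup.
From mathcomp Require Import all_solvable all_field.
From mathcomp Require Import finmap boolp classical_sets cardinality.

Set Implicit Arguments.
Unset Strict Implicit.
Unset Printing Implicit Defensive.

Import GRing.Theory.
Local Open Scope ring_scope.

(* Several group laws live on the same carrier, so they are records rather than
   canonical structures. *)
Record law (T : Type) := Law { op :> T -> T -> T; id_of : T; inv_of : T -> T }.

Definition is_group (T : Type) (G : law T) : Prop :=
  [/\ associative G, left_id (id_of G) G, right_id (id_of G) G,
      left_inverse (id_of G) (inv_of G) G &
      right_inverse (id_of G) (inv_of G) G].

Definition law_isog (T : Type) (G : law T) (gT : finGroupType) : Prop :=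
  exists f : T -> gT, bijective f /\ forall x y, f (G x y) = (f x * f y)%g.

(* The additive group is the second argument. *)
Definition skew_brace (T : Type) (circ star : law T) : Prop :=
  [/\ is_group circ, is_group star &
      forall a b c : T,
        circ a (star b c) = star (star (circ a b) (inv_of star a)) (circ a c)].

Definition bi_skew_brace (T : Type) (G1 G2 : law T) : Prop :=
  skew_brace G1 G2 /\ skew_brace G2 G1.

Section Stable.
Variable T : finType.
Implicit Types circ star : law T.

Definition subgroup (G : law T) (A : {set T}) : bool :=
  [&& id_of G \in A,
      [forall x in A, [forall y in A, G x y \in A]] &
      [forall x in A, inv_of G x \in A]].

(* lambda_circ(g) lambda_star(x) lambda_circ(g)^-1 = lambda_star(y) in Perm(T) *)
Definition conj_lambda circ star (g x y : T) : bool :=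
  [forall z, circ g (star x (circ (inv_of circ g) z)) == star y z].

Definition stable_subgroup circ star (A : {set T}) : bool :=
  subgroup star A &&
  [forall g, [forall x in A, [exists y in A, conj_lambda circ star g x y]]].

Definition stable_ratio circ star : rat :=
  #|[set A : {set T} | stable_subgroup circ star A]%SET|%:R
  / #|[set A : {set T} | subgroup circ A]%SET|%:R.

End Stable.

(* L/F is a Galois extension and i identifies the group circ with its Galois
   group. The product of [gal_of] composes in diagrammatic order, so the
   morphism condition is stated through composition of functions. *)
Definition galois_with (T : finType) (circ : law T) (F : fieldType)
    (L : splittingFieldType F) (i : T -> gal_of {:L}) : Prop :=
  [/\ galois 1%AS {:L}%AS,
      injective i,
      (i @: [set: T])%SET = 'Gal({:L} / 1%AS)%g &
      forall (g h : T) (a : L), i (circ g h) a = i g (i h a)].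

(* The Hopf Galois structure on L/F given by the regular subgroup
   N = lambda_star(T) of Perm(T), by Greither-Pareigis. An element of L[N] is
   its family of coefficients, c standing for \sum_x c x lambda_star(x). *)
Section HopfGalois.
Variables (T : finType) (circ star : law T).
Variables (F : fieldType) (L : splittingFieldType F) (i : T -> gal_of {:L}).

Definition ga_one : {ffun T -> L} := [ffun x => (x == id_of star)%:R].
Definition ga_mul (c d : {ffun T -> L}) : {ffun T -> L} :=
  [ffun z => \sum_x \sum_(y | star x y == z) c x * d y].
Definition ga_antipode (c : {ffun T -> L}) : {ffun T -> L} :=
  [ffun x => c (inv_of star x)].
Definition ga_counit (c : {ffun T -> L}) : L := \sum_x c x.

(* L[N] (x)_L L[N] is identified with the functions on T * T. *)
Definition ga_tensor (c d : {ffun T -> L}) : {ffun T * T -> L} :=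
  [ffun z => c z.1 * d z.2].
Definition ga_comul (c : {ffun T -> L}) : {ffun T * T -> L} :=
  [ffun z => if z.1 == z.2 then c z.1 else 0].

(* H = L[N]^T, where g in T acts on L through i and on N through conjugation by
   lambda_circ(g). *)
Definition in_hopf (c : {ffun T -> L}) : Prop :=
  forall g x y, conj_lambda circ star g x y -> c y = i g (c x).

(* eta in N acts on L as eta^-1(1), an element of the Galois group. *)
Definition hopf_act (c : {ffun T -> L}) (a : L) : L :=
  \sum_x c x * i (star (inv_of star x) (id_of circ)) a.

(* F-sub-Hopf algebras of H. Since H is an F-form of L[N], the space W (x)_F W
   embeds in L[N] (x)_L L[N], as the set of sums of tensors of elements of W. *)
Definition sub_hopf (W : {vspace {ffun T -> L}}) : Prop :=
  [/\ forall c, c \in W -> in_hopf c,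
      ga_one \in W,
      forall c d, c \in W -> d \in W -> ga_mul c d \in W,
      forall c, c \in W -> ga_antipode c \in W &
      forall c, c \in W -> exists s : seq ({ffun T -> L} * {ffun T -> L}),
        (forall u, u \in s -> (u.1 \in W) && (u.2 \in W)) /\
        ga_comul c = \sum_(u <- s) ga_tensor u.1 u.2].

Definition is_fixed_field (W : {vspace {ffun T -> L}}) (E : {subfield L}) : Prop :=
  forall a : L,
    a \in E <-> (forall c, c \in W -> hopf_act c a = ga_counit c * a).

Definition galois_image : set {subfield L} :=
  fun E => exists W : {vspace {ffun T -> L}}, sub_hopf W /\ is_fixed_field W E.

(* [fset_set] is empty on an infinite set, so this is nonzero only if there are
   finitely many intermediate fields. *)
Definition GC : rat :=
  #|` fset_set galois_image|%:R / #|` fset_set [set: {subfield L}]%classic|%:R.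

End HopfGalois.

(* For m, n > 1, 'Z_m is Z/mZ, and a representative s < n of an element of 'Z_n
   is used as an exponent. *)
Definition zprod (m n : nat) : finType := ('Z_m * 'Z_n)%type.

Definition add_law (m n : nat) : law (zprod m n) :=
  Law (fun x y : 'Z_m * 'Z_n => (x.1 + y.1, x.2 + y.2)) (0, 0)
      (fun x : 'Z_m * 'Z_n => (- x.1, - x.2)).

Definition semidirect_law (m n : nat) (b : int) : law (zprod m n) :=
  Law (fun x y : 'Z_m * 'Z_n =>
         (x.1 + b%:~R ^+ nat_of_ord x.2 * y.1, x.2 + y.2))
      (0, 0)
      (fun x : 'Z_m * 'Z_n => (- (b%:~R ^+ nat_of_ord (- x.2) * x.1), - x.2)).

Definition sigma (m : nat) : nat := \sum_(d <- divisors m) d.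
Definition squarefree (m : nat) : Prop := forall d : nat, (d * d %| m)%N -> d = 1%N.

(* Main.v *)
Require Import Defs.
From HB Require Import structures.
From mathcomp Require Import finmap boolp classical_sets cardinality.
From mathcomp Require Import all_boot all_order all_algebra all_fingroup.
From mathcomp Require Import all_solvable all_field.
From mathcomp Require Import ring lra.

Set Implicit Arguments.
Unset Strict Implicit.
Unset Printing Implicit Defensive.

Import Order.TTheory GRing.Theory Num.Theory.
Local Open Scope ring_scope.

(* The coefficients of a Hopf subalgebra W of H = L[N]^T are supported on the set
   A of all x in T that occur in some element of W. Slicing the comultiplication
   of elements of W shows that A spans the same L-space as W, so that A is a
   circ-stable subgroup and the fixed field of W is the field fixed by i(A).
   Conversely each stable A supports the Hopf subalgebra of elements of H with
   coefficients in A, and a stable subgroup of star is a subgroup of circ, so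
   that distinct stable subgroups have distinct fixed fields: GC is the ratio of
   the numbers of stable subgroups of star and of subgroups of circ.

   As 1 - b^s is a unit modulo m unless s = 0 modulo n, a +-stable subgroup of
   the semidirect product which is not inside Z_m contains Z_m, and a subgroup
   with nontrivial image K in Z_n and kernel A in Z_m is one of the [Z_m : A]
   twists of K by a coboundary modulo A. Summing the indices [Z_m : A] over all
   A gives sigma(m). *)

(** * Hopf subalgebras and stable subgroups *)

Section Law.
Variables (T : Type) (G : law T).
Hypothesis gG : is_group G.

Lemma lawK x : cancel (G x) (G (inv_of G x)).
Proof. by case: gG => A L1 R1 LV RV y; rewrite A LV L1. Qed.

Lemma lawVK x : cancel (G (inv_of G x)) (G x).
Proof. by case: gG => A L1 R1 LV RV y; rewrite A RV L1. Qed.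

Lemma law_rcancel z : injective (G^~ z).
Proof.
case: gG => A L1 R1 LV RV x y /(congr1 (G^~ (inv_of G z))).
by rewrite /= -!A RV !R1.
Qed.

Lemma law_invK x : inv_of G (inv_of G x) = x.
Proof.
case: gG => A L1 R1 LV RV.
by apply: (@law_rcancel (inv_of G x)); rewrite /= LV RV.
Qed.

End Law.

(** * Skew braces and their stable subgroups *)

Section SkewBrace.
Variables (T : finType) (circ star : law T).
Hypothesis sb : skew_brace circ star.

Let gcirc : is_group circ := let: And3 h _ _ := sb in h.
Let gstar : is_group star := let: And3 _ h _ := sb in h.

(** The right-handed variant of the usual lambda map of a skew brace: the inverse stands on the
    right because this is what conjugation of [lambda_star(x)] by [lambda_circ(g)] produces. *)
Definition brace_act g x := star (circ g x) (inv_of star g).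

Lemma brace_actE g x z : circ g (star x z) = star (brace_act g x) (circ g z).
Proof. by case: sb => _ _ ->. Qed.

(** The brace relation at the neutral element of [star] shows that [brace_act a] fixes it, so that
    it is right neutral for [circ]. *)
Lemma brace_id : id_of star = id_of circ.
Proof.
case: gcirc => A L1 R1 LV RV; case: gstar => A' L1' R1' LV' RV'.
have e a : circ a (id_of star) = a.
  apply: (law_rcancel gstar (z := inv_of star a)); rewrite /= RV'.
  apply: (law_rcancel gstar (z := circ a (id_of star))); rewrite /= L1'.
  by rewrite -[LHS]/(star (brace_act a (id_of star)) _) -brace_actE L1'.
by rewrite -[LHS]L1 e.
Qed.

Lemma conj_lambdaE g x y : conj_lambda circ star g x y = (y == brace_act g x).
Proof.
apply/forallP/eqP => [/(_ g)/eqP|-> z]; last by rewrite brace_actE lawVK.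
rewrite brace_actE.
case: gcirc => A L1 R1 LV RV; rewrite LV R1.
by move/(law_rcancel gstar).
Qed.

Lemma brace_act1 x : brace_act (id_of circ) x = x.
Proof.
case: gcirc => A L1 R1 LV RV; case: gstar => A' L1' R1' LV' RV'.
by rewrite /brace_act L1 -brace_id -[inv_of _ _]L1' RV' R1'.
Qed.

Lemma brace_actM g h x :
  brace_act (circ g h) x = brace_act g (brace_act h x).
Proof.
case: gcirc => A L1 R1 LV RV.
apply: (@law_rcancel _ _ gstar (circ (circ g h) x)); rewrite /= -brace_actE.
by rewrite -!A -brace_actE -brace_actE.
Qed.

Lemma brace_actK g : cancel (brace_act g) (brace_act (inv_of circ g)).
Proof.
case: gcirc => A L1 R1 LV RV x.
by rewrite -brace_actM LV brace_act1.
Qed.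

Lemma brace_actVK g : cancel (brace_act (inv_of circ g)) (brace_act g).
Proof.
case: gcirc => A L1 R1 LV RV x.
by rewrite -brace_actM RV brace_act1.
Qed.

Lemma subgroupP (G : law T) (A : {set T}) :
  reflect [/\ id_of G \in A, forall x y, x \in A -> y \in A -> G x y \in A
            & forall x, x \in A -> inv_of G x \in A]
          (subgroup G A).
Proof.
apply: (iffP and3P) => [[h1 /forall_inP hM /forall_inP hV]|[h1 hM hV]].
  by split=> // x y /hM/forall_inP; apply.
split=> //; first by apply/forall_inP => x xA; apply/forall_inP => y; apply: hM.
exact/forall_inP.
Qed.

Lemma stable_subgroupP (A : {set T}) :
  reflect (subgroup star A /\ forall g x, x \in A -> brace_act g x \in A)
          (stable_subgroup circ star A).
Proof.
apply: (iffP andP) => -[sA hA]; split=> //; [move=> g x xA|].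
  move/forallP/(_ g)/forall_inP/(_ x xA)/exists_inP: hA => [y yA].
  by rewrite conj_lambdaE => /eqP <-.
apply/forallP => g; apply/forall_inP => x xA; apply/exists_inP.
by exists (brace_act g x); rewrite ?conj_lambdaE ?hA.
Qed.

(** Closure under [circ] comes from [circ x y = star (brace_act x y) x]. For inverses, if [x'] is
    the [circ]-inverse of [x], then [brace_act x' x] is the [star]-inverse of [x']. *)
Lemma stable_subgroup_circ (A : {set T}) :
  stable_subgroup circ star A -> subgroup circ A.
Proof.
move=> /stable_subgroupP[/subgroupP[h1 hM hV] hA]; apply/subgroupP.
case: gcirc => As L1 R1 LV RV; case: gstar => As' L1' R1' LV' RV'.
split=> [|x y xA yA|x xA]; first by rewrite -brace_id.
  have -> : circ x y = star (brace_act x y) x by rewrite -As' LV' R1'.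
  by rewrite hM ?hA.
have := hA (inv_of circ x) x xA; rewrite /brace_act LV -brace_id L1'.
by move/hV; rewrite law_invK.
Qed.

End SkewBrace.

Section HopfGaloisCorrespondence.
Variables (T : finType) (circ star : law T).
Variables (F : fieldType) (L : splittingFieldType F) (i : T -> gal_of {:L}).
Hypothesis sb : skew_brace circ star.
Hypothesis gi : galois_with circ i.

Let gcirc : is_group circ := let: And3 h _ _ := sb in h.
Let gstar : is_group star := let: And3 _ h _ := sb in h.
Let act := brace_act circ star.

(** * Dual bases of L/F and elements of trace 1 *)

Lemma galois_withM g h a : i (circ g h) a = i g (i h a).
Proof. by case: gi. Qed.

Lemma galois_with1 a : i (id_of circ) a = a.
Proof.
case: gcirc => A L1 R1 LV RV.
by apply: (fmorph_inj (i (id_of circ))); rewrite /= -galois_withM L1.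
Qed.

Lemma galois_with_moves g :
  g != id_of circ -> exists a : L, i g a != a.
Proof.
move=> ng; apply: contrapT => h.
case: gi => _ inj _ _; case/eqP: ng; apply: inj; apply/eqP/gal_eqP => a _.
rewrite galois_with1; apply/eqP/negPn/negP => na; apply: h.
by exists a.
Qed.

(* These are dual bases of L/F for the trace form, built as a product of
   the functions g |-> (g a - r a) / (a - r a). *)
Lemma trace_dual_bases : exists s : seq (L * L), forall g h : T,
  \sum_(u <- s) i g u.1 * i h u.2 = (g == h)%:R.
Proof.
suff [s hs] : exists s : seq (L * L), forall g : T,
    \sum_(u <- s) u.1 * i g u.2 = (g == id_of circ)%:R.
  case: gcirc => A L1 R1 LV RV.
  exists s => g h; transitivity (i g (\sum_(u <- s) u.1 *
      i (circ (inv_of circ g) h) u.2)).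
    rewrite rmorph_sum /=; apply: eq_bigr => u _.
    by rewrite rmorphM /= -galois_withM lawVK.
  rewrite hs rmorph_nat; congr (_%:R); congr nat_of_bool; apply/eqP/eqP => [e|->].
    by rewrite -[h](lawVK gcirc g) e R1.
  exact: LV.
(* Induction on the list of group elements to be killed: each new element [r] multiplies the
   function of [g] by a factor equal to 1 at the identity and to 0 at [r]. The two halves of [s']
   expand this product. *)
suff h (r : seq T) : id_of circ \notin r -> exists s : seq (L * L),
    \sum_(u <- s) u.1 * u.2 = 1 /\
    forall g, g \in r -> \sum_(u <- s) u.1 * i g u.2 = 0.
  have /h[s [s1 s0]] : id_of circ \notin enum (predC1 (id_of circ)).
    by rewrite mem_enum inE eqxx.
  exists s => g; have [->|ng] := eqVneq.
    by rewrite -[RHS]s1; apply: eq_bigr => u _; rewrite galois_with1.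
  by apply: s0; rewrite mem_enum.
elim: r => [_|r l IHl]; first by exists [:: (1, 1)]; rewrite big_seq1 mulr1.
rewrite inE negb_or eq_sym => /andP[/galois_with_moves[a ra] /IHl[s [s1 s0]]].
pose d := (a - i r a)^-1.
pose s' := [seq (u.1 * d, u.2 * a) | u <- s]
        ++ [seq (- (u.1 * d * i r a), u.2) | u <- s].
have es' g : \sum_(u <- s') u.1 * i g u.2
           = (\sum_(u <- s) u.1 * i g u.2) * (d * (i g a - i r a)).
  rewrite big_cat !big_map /= -big_split mulr_suml; apply: eq_bigr => u _ /=.
  rewrite rmorphM mulNr mulrBr mulrBr; congr (_ - _).
    by rewrite mulrACA.
  by rewrite -[u.1 * d * _]mulrA mulrAC.
exists s'; split=> [|g].
  have := es' (id_of circ); rewrite galois_with1 mulVf ?subr_eq0 1?eq_sym //.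
  rewrite mulr1 => e; transitivity (\sum_(u <- s') u.1 * i (id_of circ) u.2).
    by apply: eq_bigr => u _; rewrite galois_with1.
  by rewrite e -[RHS]s1; apply: eq_bigr => u _; rewrite galois_with1.
rewrite inE es' => /predU1P[->|/s0->]; last by rewrite mul0r.
by rewrite subrr !mulr0.
Qed.

(** If all traces vanished, summing the duality relation over its second index would give 1 = 0. A
    nonzero trace is fixed by the Galois group, so dividing by it is compatible with the trace. *)
Lemma trace_one : exists t : L, \sum_g i g t = 1.
Proof.
have [s hs] := trace_dual_bases.
have [a na] : exists a : L, \sum_g i g a != 0.
  apply: contrapT => h; have := oner_neq0 L; case/eqP.
  transitivity (\sum_(u <- s) i (id_of circ) u.1 * \sum_g i g u.2); last first.
    rewrite big1_seq // => u _; case: (eqVneq (\sum_g i g u.2) 0) => [->|nz].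
      by rewrite mulr0.
    by case: h; exists u.2.
  under eq_bigr do rewrite mulr_sumr.
  rewrite exchange_big (bigD1 (id_of circ)) //= hs eqxx big1 ?addr0 // => g ng.
  by rewrite hs eq_sym (negPf ng).
have fa h : i h (\sum_g i g a) = \sum_g i g a.
  rewrite rmorph_sum [RHS](reindex_inj (can_inj (lawK gcirc h))) /=.
  by apply: eq_bigr => g _; rewrite galois_withM.
exists (a / \sum_g i g a).
under eq_bigr => g _ do rewrite rmorphM fmorphV /= fa.
by rewrite -mulr_suml mulfV.
Qed.

(** * The support of a Hopf subalgebra *)

Lemma in_hopfP (c : {ffun T -> L}) :
  in_hopf circ star i c <-> forall g x, c (act g x) = i g (c x).
Proof.
split=> [h g x|h g x y]; first by apply: h; rewrite conj_lambdaE.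
by rewrite conj_lambdaE // => /eqP ->.
Qed.

Definition hopf_supp (W : {vspace {ffun T -> L}}) : {set T} :=
  [set x | `[< exists2 c, c \in W & c x != 0 >]].

Lemma hopf_suppP (W : {vspace {ffun T -> L}}) x :
  reflect (exists2 c, c \in W & c x != 0) (x \in hopf_supp W).
Proof. by rewrite inE; apply: asboolP. Qed.

(* Slicing the comultiplication shows that the L-span of W contains the
   group-like element of each x in the support of W. *)
Lemma sub_hopf_separates W (f : T -> L) : sub_hopf circ star i W ->
  (forall c, c \in W -> \sum_x c x * f x = 0) ->
  forall x, x \in hopf_supp W -> f x = 0.
Proof.
case=> _ _ _ _ hD h y /hopf_suppP[c cW cy].
have [s [sW e]] := hD c cW.
apply: (mulfI cy); rewrite mulr0.
(* The second tensor coordinate is frozen at [y]: the diagonal form of [ga_comul] leaves only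
   [c y * f y], while its decomposition over W leaves L-multiples of pairings of [f] with elements
   of W. *)
transitivity (\sum_x ga_comul c (x, y) * f x).
  rewrite (bigD1 y) //= big1 => [|x nx]; first by rewrite addr0 ffunE eqxx.
  by rewrite ffunE /= (negPf nx) mul0r.
transitivity (\sum_(u <- s) u.2 y * \sum_x u.1 x * f x).
  rewrite e; under [RHS]eq_bigr do rewrite mulr_sumr.
  rewrite exchange_big; apply: eq_bigr => x _.
  rewrite sum_ffunE mulr_suml; apply: eq_bigr => u _.
  by rewrite ffunE mulrA [u.2 y * _]mulrC.
rewrite big1_seq // => u /andP[_ /sW/andP[u1 _]].
by rewrite h ?mulr0.
Qed.

Lemma hopf_supp_stable W :
  sub_hopf circ star i W -> stable_subgroup circ star (hopf_supp W).
Proof.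
move=> sW; have [Win W1 WM WV _] := sW.
apply/(stable_subgroupP sb); split; first apply/subgroupP; last first.
  move=> g x /hopf_suppP[c cW cx]; apply/hopf_suppP; exists c => //.
  by have /in_hopfP-> := Win _ cW; rewrite fmorph_eq0.
split=> [|x y xW /hopf_suppP[d dW dy]|x /hopf_suppP[c cW cx]].
- by apply/hopf_suppP; exists (ga_one star L); rewrite // ffunE eqxx oner_neq0.
- apply/hopf_suppP; apply: contrapT => nxy; case/eqP: dy.
  (* The pairing of [c] with [f] is the coefficient of [ga_mul star c d] at [star x y]. If it
     vanished for every [c] in W, then so would [f x], which is [d y]. *)
  pose f x' := \sum_(y' | star x' y' == star x y) d y'.
  transitivity (f x).
    rewrite /f (bigD1 y) //= big1 ?addr0 // => y' /andP[/eqP e /eqP []].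
    by rewrite -[y'](lawK gstar x) e lawK.
  apply: sub_hopf_separates xW => // c cW.
  apply/eqP; apply: contrapT => /negP ne; apply: nxy.
  exists (ga_mul star c d); first exact: WM.
  by rewrite ffunE; under eq_bigr do rewrite -mulr_sumr.
- apply/hopf_suppP; exists (ga_antipode star c); first exact: WV.
  by rewrite ffunE law_invK.
Qed.

(** Separation, applied to [i (inv_of star x) a - a], turns the equations indexed by W into
    pointwise ones. Passing between [x] and its [star]-inverse is harmless, the support being a
    subgroup. *)
Lemma fixed_field_hopf_supp W (E : {subfield L}) : sub_hopf circ star i W ->
  is_fixed_field circ star i W E <->
  forall a : L, a \in E <-> forall x, x \in hopf_supp W -> i x a = a.
Proof.
move=> sW.
suff e a : (forall c, c \in W -> hopf_act circ star i c a = ga_counit c * a) <->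
           (forall x, x \in hopf_supp W -> i x a = a).
  by split=> h a; apply: iff_trans (h a) _; [apply: e | apply: iff_sym].
have /(stable_subgroupP sb)[/subgroupP[_ _ Vh] _] := hopf_supp_stable sW.
have inv1 x : star (inv_of star x) (id_of circ) = inv_of star x.
  by case: gstar => _ _ R1 _ _; rewrite -(brace_id sb) R1.
split=> [h x /Vh xW|h c cW].
  apply/eqP; rewrite -subr_eq0; apply/eqP.
  have := @sub_hopf_separates W (fun x => i (inv_of star x) a - a) sW.
  move/(_ _ (inv_of star x) xW); rewrite law_invK //; apply=> c /h.
  rewrite /hopf_act /ga_counit => e; under eq_bigr do rewrite mulrBr.
  rewrite sumrB -mulr_suml -e; apply/eqP; rewrite subr_eq0; apply/eqP.
  by apply: eq_bigr => z _; rewrite inv1.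
rewrite /hopf_act /ga_counit mulr_suml; apply: eq_bigr => x _; rewrite inv1.
have [->|nz] := eqVneq (c x) 0; first by rewrite !mul0r.
by congr (_ * _); apply/h/Vh/hopf_suppP; exists c.
Qed.

(** * The Hopf subalgebra supported on a stable subgroup *)

Definition hopf_defect (c : {ffun T -> L}) : {ffun T * T -> L} :=
  [ffun z => c (act z.1 z.2) - i z.1 (c z.2)].

Fact hopf_defect_linear : linear hopf_defect.
Proof.
move=> k c d; apply/ffunP => z; rewrite !ffunE linearP scalerBr.
by rewrite opprD addrACA.
Qed.

HB.instance Definition _ :=
  GRing.isLinear.Build F {ffun T -> L} {ffun T * T -> L} _ hopf_defect
    hopf_defect_linear.

Definition off_part (A : {set T}) (c : {ffun T -> L}) : {ffun T -> L} :=
  [ffun x => if x \in A then 0 else c x].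

Fact off_part_linear A : linear (off_part A).
Proof.
move=> k c d; apply/ffunP => z; rewrite !ffunE.
by case: ifP => _; rewrite ?scaler0 ?addr0.
Qed.

HB.instance Definition _ A :=
  GRing.isLinear.Build F {ffun T -> L} {ffun T -> L} _ (off_part A)
    (off_part_linear A).

(** The elements of H with coefficients in [A], cut out by two F-linear maps so as to form a
    [{vspace}]. *)
Definition hopf_on (A : {set T}) : {vspace {ffun T -> L}} :=
  (lker (linfun hopf_defect) :&: lker (linfun (off_part A)))%VS.

Lemma hopf_onP (A : {set T}) (c : {ffun T -> L}) : reflect
  ((forall g x, c (act g x) = i g (c x)) /\ (forall x, x \notin A -> c x = 0))
  (c \in hopf_on A).
Proof.
rewrite memv_cap !memv_ker !lfunE /=.
apply: (iffP andP) => -[h1 h2]; split.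
- move=> g x; move/eqP/ffunP/(_ (g, x)): h1; rewrite !ffunE /=.
  by move/eqP; rewrite subr_eq0 => /eqP.
- by move=> x nx; move/eqP/ffunP/(_ x): h2; rewrite !ffunE (negPf nx).
- by apply/eqP/ffunP => z; rewrite !ffunE h1 subrr.
- by apply/eqP/ffunP => x; rewrite !ffunE; case: ifPn => // /h2.
Qed.

(** The trace over [T] of the element [a lambda_star(x)] of L[N], which therefore lies in H. *)
Definition orbit_elt (a : L) (x : T) : {ffun T -> L} :=
  [ffun y => \sum_(g | act g x == y) i g a].

Lemma orbit_elt_on A a x :
  stable_subgroup circ star A -> x \in A -> orbit_elt a x \in hopf_on A.
Proof.
move=> /(stable_subgroupP sb)[_ hA] xA; apply/hopf_onP; split.
  move=> g y; rewrite !ffunE rmorph_sum /=.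
  rewrite (reindex_inj (can_inj (lawK gcirc g))) /=; apply: eq_big => [h|h _].
    by rewrite /act brace_actM // (can_eq (brace_actK sb g)).
  exact: galois_withM.
move=> y ny; rewrite ffunE big1 // => g /eqP e.
by rewrite -e hA in ny.
Qed.

Lemma hopf_on_sub_hopf A :
  stable_subgroup circ star A -> sub_hopf circ star i (hopf_on A).
Proof.
move=> sA; have /(stable_subgroupP sb)[/subgroupP[A1 AM AV] hA] := sA.
have [As L1 R1 LV RV] := gstar.
(* [act g] is an automorphism of [star], being a conjugation on N. *)
have aM g x y : act g (star x y) = star (act g x) (act g y).
  by rewrite /act /brace_act (brace_actE sb) -As.
have a1 g : act g (id_of star) = id_of star.
  apply: (law_rcancel gstar (z := act g (id_of star))).
  by rewrite /= -aM L1 L1.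
have aV g x : act g (inv_of star x) = inv_of star (act g x).
  by apply: (law_rcancel gstar (z := act g x)); rewrite /= -aM !LV a1.
split=> [c /hopf_onP[hc _]| | c d /hopf_onP[hc cA] /hopf_onP[hd dA]
        | c /hopf_onP[hc cA]| c /hopf_onP[hc cA]].
- exact/in_hopfP.
- apply/hopf_onP; split=> [g x|x nx]; rewrite !ffunE.
    by rewrite -{1}(a1 g) (can_eq (brace_actK sb g)) rmorph_nat.
  by case: eqP nx => // ->; rewrite A1.
- apply/hopf_onP; split=> [g z|z nz]; rewrite !ffunE.
    rewrite rmorph_sum (reindex_inj (can_inj (brace_actK sb g))) /=.
    apply: eq_bigr => x _; rewrite rmorph_sum /=.
    rewrite (reindex_inj (can_inj (brace_actK sb g))) /=.
    apply: eq_big => [y|y _].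
      by rewrite -[X in X == _]aM (can_eq (brace_actK sb g)).
    by rewrite rmorphM /= -hc -hd.
  rewrite big1 // => x _; rewrite big1 // => y /eqP e.
  have [xA|/cA->] := boolP (x \in A); last by rewrite mul0r.
  have [yA|/dA->] := boolP (y \in A); last by rewrite mulr0.
  by rewrite -e AM in nz.
- apply/hopf_onP; split=> [g x|x nx]; rewrite !ffunE.
    by rewrite -aV hc.
  by apply: cA; apply: contra nx => /AV; rewrite law_invK.
(* The decomposition of the comultiplication: summing over the dual bases forces [g = h], hence
   equal tensor coordinates. Each [g] reaches a given [y] of [A] from exactly one [x], with weight
   [i g t * c y], and these weights add up to [c y] because [t] has trace 1. *)
have [s hs] := trace_dual_bases; have [t ht] := trace_one.
exists [seq (orbit_elt (u.1 * (t * c x)) x, orbit_elt u.2 x)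
       | x <- enum A, u <- s]; split.
  move=> _ /allpairsP[[x u] [/= xA uS ->]] /=.
  by rewrite mem_enum in xA; rewrite !orbit_elt_on.
apply/ffunP => -[y z]; rewrite sum_ffunE big_allpairs_dep /= ffunE /=.
transitivity (\sum_(x in A) \sum_(g | act g x == y) \sum_(h | act h x == z)
                 i g (t * c x) * (g == h)%:R); last first.
  rewrite [RHS]big_enum /=; apply: eq_bigr => x _.
  under [RHS]eq_bigr do rewrite !ffunE /= mulr_suml.
  rewrite [RHS]exchange_big; apply: eq_bigr => g _ /=.
  under [RHS]eq_bigr do rewrite mulr_sumr.
  rewrite [RHS]exchange_big; apply: eq_bigr => h _ /=.
  rewrite -hs mulr_sumr; apply: eq_bigr => u _.
  by rewrite [in RHS]rmorphM mulrAC mulrC.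
transitivity (\sum_(x in A) \sum_(g | act g x == y)
   (if y == z then i g t * c y else 0)).
  case: ifP => [_|_]; last by rewrite big1 // => x _; rewrite big1.
  rewrite (exchange_big_dep xpredT) //=.
  transitivity (\sum_g i g t * c y); first by rewrite -mulr_suml ht mul1r.
  have [yA|ny] := boolP (y \in A); last first.
    rewrite cA // big1 => [|g _]; last by rewrite mulr0.
    by rewrite big1 // => g _; rewrite big1 // => x _; rewrite mulr0.
  apply: eq_bigr => g _; rewrite (big_pred1 (act (inv_of circ g) y)) // => x.
  apply/andP/eqP => [[_ /eqP <-]|->]; first by rewrite /act (brace_actK sb).
  by rewrite hA // /act (brace_actVK sb).
apply: eq_bigr => x xA; apply: eq_bigr => g /eqP gx.
have [yz|yz] := eqVneq y z.
  rewrite (bigD1 g) /= ?gx ?yz // eqxx mulr1 big1 => [|h /andP[_ nh]].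
    by rewrite addr0 rmorphM /= -hc gx yz.
  by rewrite eq_sym (negPf nh) mulr0.
rewrite big1 // => h /eqP hx; case: eqP => [e|]; last by rewrite mulr0.
by rewrite -gx -hx e eqxx in yz.
Qed.

(** For [x] in [A], if every [orbit_elt a x] vanished at [x], the dual bases would give 1 = 0. *)
Lemma hopf_supp_on A :
  stable_subgroup circ star A -> hopf_supp (hopf_on A) = A.
Proof.
move=> sA; apply/setP => x; apply/hopf_suppP/idP => [[c /hopf_onP[_ h]]|xA].
  by apply: contraNT => /h ->.
have [s hs] := trace_dual_bases.
apply: contrapT => h; have := oner_neq0 L; case/eqP.
have := hs (id_of circ); move=> hs1.
transitivity (\sum_(u <- s) i (id_of circ) u.1 * orbit_elt u.2 x x).
  under eq_bigr do rewrite ffunE mulr_sumr.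
  rewrite exchange_big (bigD1 (id_of circ)) /=; last by rewrite /act brace_act1.
  rewrite hs eqxx big1 ?addr0 // => g /andP[_ ng].
  by rewrite hs eq_sym (negPf ng).
rewrite big1_seq // => u _; case: (eqVneq (orbit_elt u.2 x x) 0) => [->|nz].
  by rewrite mulr0.
by case: h; exists (orbit_elt u.2 x); first exact: orbit_elt_on.
Qed.

(** * The classical Galois correspondence for [circ], and the ratio [GC] *)

Definition law_fixed (A : {set T}) : {subfield L} :=
  fixedField_aspace [set i x | x in A]%SET.

Lemma law_fixedP (A : {set T}) a :
  reflect (forall x, x \in A -> i x a = a) (a \in law_fixed A).
Proof.
apply: (iffP (fixedFieldP (memvf a))) => [h x xA|h _ /imsetP[x xA ->]].
  by apply: h; apply: imset_f.
exact: h.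
Qed.

Lemma galois_with_mulg g h : i (circ g h) = (i h * i g)%g.
Proof.
by apply/eqP/gal_eqP => a _; rewrite galM ?memvf // galois_withM.
Qed.

(** By Artin's theorem the Galois group of L over the fixed field of i(A) is i(A) itself, which
    recovers [A]. *)
Lemma law_fixed_inj :
  {in [pred A | subgroup circ A] &, injective law_fixed}.
Proof.
have gset A : subgroup circ A -> group_set [set i x | x in A]%SET.
  move=> /subgroupP[A1 AM _]; apply/group_setP; split.
    apply/imsetP; exists (id_of circ) => //.
    by apply/esym/eqP/gal_eqP => a _; rewrite galois_with1 gal_id.
  move=> _ _ /imsetP[x xA ->] /imsetP[y yA ->]; rewrite -galois_with_mulg.
  by apply: imset_f; apply: AM.
move=> A B /gset gA /gset gB /(congr1 (fun E : {subfield L} => 'Gal({:L} / E)%g)).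
rewrite /= (gal_fixedField (Group gA)) (gal_fixedField (Group gB)) /=.
by case: gi => _ inj _ _; apply: imset_inj.
Qed.

Lemma law_fixed_surj E : exists2 A, subgroup circ A & E = law_fixed A.
Proof.
have [gal_L inj_i im_i _] := gi.
have gE : galois E {:L}.
  apply: galoisS gal_L; apply/andP; split; last exact: subvf.
  exact: sub1v.
exists [set x | i x \in 'Gal({:L} / E)%g]%SET.
  apply/subgroupP.
  have i1 : i (id_of circ) = 1%g.
    by apply/eqP/gal_eqP => a _; rewrite galois_with1 gal_id.
  split=> [|x y|x]; rewrite !inE ?i1 ?group1 //.
    by rewrite galois_with_mulg => xE yE; apply: groupM.
  move=> xE; have -> : i (inv_of circ x) = ((i x)^-1)%g.
    apply/eqP; rewrite eq_mulgV1 invgK -galois_with_mulg.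
    by case: gcirc => _ _ _ _ ->; rewrite i1.
  exact: groupVr.
apply/val_inj; rewrite /= -{1}(galois_fixedField gE); congr fixedField.
apply/setP => y; apply/idP/imsetP => [yE|[x]]; last by rewrite inE => xE ->.
have : y \in [set i x | x in [set: T]]%SET.
  rewrite im_i; apply: subsetP yE; apply: galS; exact: sub1v.
by case/imsetP => x _ e; exists x; rewrite // inE -e.
Qed.

Lemma card_fset_set_image (T' : finType) (U : choiceType) (f : T' -> U)
    (P : pred T') : {in P &, injective f} ->
  #|` fset_set [set f x | x in [set x | P x]]%classic| = #|[set x | P x]%SET|.
Proof.
move=> f_inj; rewrite fset_set_image; last exact: finite_finset.
have -> : fset_set [set x | P x]%classic = [fset x in enum P]%fset.
  apply/fsetP => x; rewrite in_fset_set; last exact: finite_finset.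
  by apply/idP/idP; rewrite !finmap.inE !classical_sets.inE /= mem_enum.
rewrite card_in_imfset => [|x y /=]; last by rewrite !finmap.inE !mem_enum; apply: f_inj.
by rewrite card_fseq undup_id ?enum_uniq // -cardE cardsE; apply/eq_card.
Qed.

Theorem GC_stable_ratio : GC circ star i = stable_ratio circ star.
Proof.
rewrite /GC /stable_ratio; congr (_%:R / _%:R).
  rewrite -(@card_fset_set_image _ _ law_fixed); last first.
    move=> A B sA sB; apply: law_fixed_inj; apply: (stable_subgroup_circ sb).
      exact: sA.
    exact: sB.
  congr #|` fset_set _|; apply/seteqP; split=> E /=.
    move=> [W [sW fW]]; exists (hopf_supp W); first exact: hopf_supp_stable.
    have fE := (fixed_field_hopf_supp E sW).1 fW.
    by apply/val_inj/vspaceP => a; apply/law_fixedP/idP => /fE.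
  move=> [A sA <-]; exists (hopf_on A); split; first exact: hopf_on_sub_hopf.
  apply/fixed_field_hopf_supp; first exact: hopf_on_sub_hopf.
  by move=> a; rewrite hopf_supp_on //; split=> /law_fixedP.
rewrite -(@card_fset_set_image _ _ law_fixed); last exact: law_fixed_inj.
congr #|` fset_set _|; apply/seteqP; split=> E //= _.
by have [A sA ->] := law_fixed_surj E; exists A.
Qed.

End HopfGaloisCorrespondence.

(** * Subgroups of cyclic groups and divisors of squarefree numbers *)

Lemma prime_dvd_prod (p : nat) (s : seq nat) : prime p -> all prime s ->
  (p %| \prod_(q <- s) q)%N = (p \in s).
Proof.
move=> pp; elim: s => [_|q s IHs] /=; first by rewrite big_nil Euclid_dvd1.
by case/andP=> pq /IHs{}IHs; rewrite big_cons Euclid_dvdM // dvdn_prime2 // IHs.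
Qed.

Lemma prod_primes_gt0 (s : seq nat) : all prime s -> (0 < \prod_(p <- s) p)%N.
Proof.
move=> /allP ps; rewrite big_seq; elim/big_ind: _ => // [a b|p /ps/prime_gt0//].
by rewrite muln_gt0 => -> ->.
Qed.

(** A divisor of [p * m] is either prime to [p], hence a divisor of [m], or [p] times a divisor of
    [m]. *)
Lemma sum_divisorsM (R : nmodType) (f : nat -> R) p m :
  (0 < m)%N -> prime p -> ~~ (p %| m)%N ->
  \sum_(d <- divisors (p * m)) f d =
  \sum_(d <- divisors m) f d + \sum_(d <- divisors m) f (p * d)%N.
Proof.
move=> m0 pp npm; have p0 := prime_gt0 pp.
rewrite -(big_map (muln p) xpredT f) -big_cat; apply: perm_big; apply: uniq_perm.
- exact: divisors_uniq.
- rewrite cat_uniq divisors_uniq map_inj_uniq ?divisors_uniq ?andbT; last first.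
    by move=> a b /eqP; rewrite eqn_pmul2l // => /eqP.
  apply/hasPn => _ /mapP[d _ ->]; rewrite /= -dvdn_divisors //.
  by apply: contra npm; apply: dvdn_trans; apply: dvdn_mulr.
move=> d; rewrite mem_cat -!dvdn_divisors ?muln_gt0 ?p0 //.
apply/idP/orP => [dpm|[dm|/mapP[e em ->]]]; last first.
- by rewrite dvdn_pmul2l // dvdn_divisors.
- exact: dvdn_mull.
have [/dvdnP[e de]|npd] := boolP (p %| d)%N; [right|left].
  apply/mapP; exists e; last by rewrite mulnC.
  by rewrite -dvdn_divisors // -(dvdn_pmul2l p0) mulnC -de.
by rewrite -(Gauss_dvdr _ (_ : coprime d p)) // coprime_sym prime_coprime.
Qed.

Lemma size_divisors_prod (s : seq nat) : all prime s -> uniq s ->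
  size (divisors (\prod_(p <- s) p)) = (2 ^ size s)%N.
Proof.
elim: s => [|p s IHs] /=; first by rewrite big_nil.
move=> /andP[pp ps] /andP[ns us]; rewrite big_cons.
rewrite expnS mul2n -addnn -IHs // -!sum1_size.
by rewrite (@sum_divisorsM nat) ?prod_primes_gt0 ?prime_dvd_prod.
Qed.

Lemma sigma_prod (s : seq nat) : all prime s -> uniq s ->
  sigma (\prod_(p <- s) p) = (\prod_(p <- s) (1 + p))%N.
Proof.
elim: s => [|p s IHs] /=; first by rewrite !big_nil /sigma big_cons big_nil.
move=> /andP[pp ps] /andP[ns us]; rewrite !big_cons -IHs // /sigma.
rewrite (@sum_divisorsM nat) ?prod_primes_gt0 ?prime_dvd_prod //.
by rewrite -big_distrr mulnDl mul1n.
Qed.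

(** A subgroup of a cyclic group is determined by its order, and [<[x ^+ d]>] has index [d] when [x]
    is a generator and [d] divides the order. *)
Lemma sum_index_cyclic (R : nmodType) (gT : finGroupType) (f : nat -> R) :
  cyclic [set: gT] ->
  \sum_(H : {group gT}) f #|[set: gT] : H|%g = \sum_(d <- divisors #|gT|) f d.
Proof.
move=> cyc; have gT0 : (0 < #|gT|)%N by rewrite -cardsT cardG_gt0.
transitivity (\sum_(d <- [seq #|[set: gT] : H|%g | H : {group gT}]) f d).
  by rewrite big_map big_enum.
apply: perm_big; apply: uniq_perm.
- rewrite map_inj_uniq ?enum_uniq // => H K /eqP e; apply/val_inj/eqP.
  rewrite (eq_subG_cyclic cyc) ?subsetT //.
  rewrite -(eqn_pmul2r (indexg_gt0 [set: gT]%G H)) (Lagrange (subsetT H)).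
  by rewrite (eqP e) (Lagrange (subsetT K)).
- exact: divisors_uniq.
move=> d; rewrite -dvdn_divisors //; apply/mapP/idP => [[H _ ->]|dN].
  by rewrite -cardsT dvdn_indexg.
have /cyclicP[x ex] := cyc.
have ox : #[x]%g = #|gT| by rewrite orderE -ex cardsT.
have d0 : (0 < d)%N by rewrite (dvdn_gt0 gT0).
exists <[x ^+ d]>%G; first by rewrite mem_enum.
rewrite -divgS ?subsetT // cardsT -orderE orderXdiv ox //.
by rewrite divnA // mulKn.
Qed.

Lemma card_group_cyclic (gT : finGroupType) : cyclic [set: gT] ->
  #|{group gT}| = size (divisors #|gT|).
Proof. by move=> /(@sum_index_cyclic nat _ (fun=> 1%N)); rewrite sum1_card sum1_size. Qed.

Lemma card_subgroup_isog (T : finType) (G : law T) (gT : finGroupType) :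
  is_group G -> law_isog G gT ->
  #|[set A : {set T} | subgroup G A]| = #|{group gT}|.
Proof.
move=> gG [f [[f' fK f'K] fM]]; have [As L1 R1 LV RV] := gG.
have f1 : f (id_of G) = 1%g.
  by apply: (mulgI (f (id_of G))); rewrite -fM L1 mulg1.
have fV x : f (inv_of G x) = (f x)^-1%g.
  by apply: (mulgI (f x)); rewrite -fM RV f1 mulgV.
have gset (H : {group gT}) : subgroup G [set x | f x \in H].
  apply/subgroupP; split=> [|x y|x]; rewrite !inE ?f1 ?fM ?fV ?group1 //.
    exact: groupM.
  by rewrite groupV.
have -> : [set A : {set T} | subgroup G A]
        = [set [set x | f x \in H] | H : {group gT}].
  apply/setP => A; rewrite inE; apply/idP/imsetP => [sA|[H _ ->]//].
  have /subgroupP[A1 AM AV] := sA.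
  have gA : group_set [set y | f' y \in A].
    apply/group_setP; split=> [|x y]; rewrite !inE; first by rewrite -f1 fK.
    by rewrite -{2}[x]f'K -{2}[y]f'K -fM fK; apply: AM.
  exists (Group gA) => //; apply/setP => x.
  by rewrite !inE fK.
rewrite card_imset // => H K /setP e; apply/val_inj/setP => y.
by have := e (f' y); rewrite !inE f'K.
Qed.

(** * The two group laws on Z_m x Z_n *)

Section SemidirectLaw.
Variables (m n : nat) (b : int).
Hypotheses (m_gt1 : (1 < m)%N) (n_gt1 : (1 < n)%N).
Hypothesis expb : (b%:~R : 'Z_m) ^+ n = 1.

Local Notation add := (add_law m n).
Local Notation dot := (semidirect_law m n b).

Definition twist (s : 'Z_n) : 'Z_m := b%:~R ^+ s.

Lemma twist0 : twist 0 = 1.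
Proof. exact: expr0. Qed.

(** Sums in ['Z_n] are reduced modulo [n], which [expb] makes invisible in the exponent of [b]. *)
Lemma twistD s t : twist (s + t) = twist s * twist t.
Proof.
rewrite /twist -exprD -[RHS](expr_mod _ expb); congr (_ ^+ _).
by rewrite /= [X in (_ %% X)%N = _]Zp_cast.
Qed.

Lemma twistVr s : twist s * twist (- s) = 1.
Proof. by rewrite -twistD subrr twist0. Qed.

Lemma dotE (x y : zprod m n) : dot x y = (x.1 + twist x.2 * y.1, x.2 + y.2).
Proof. by []. Qed.

Lemma dotV (x : zprod m n) : inv_of dot x = (- (twist (- x.2) * x.1), - x.2).
Proof. by []. Qed.

Lemma add_is_group : is_group add.
Proof.
split=> [[a s] [c t] [d u]|[a s]|[a s]|[a s]|[a s]] /=.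
- by rewrite !addrA.
- by rewrite !add0r.
- by rewrite !addr0.
- by rewrite !addNr.
- by rewrite !addrN.
Qed.

Lemma dot_is_group : is_group dot.
Proof.
split=> [x y z|[a s]|[a s]|[a s]|[a s]]; rewrite ?dotE ?dotV /=.
- by rewrite twistD mulrDr !addrA mulrA.
- by rewrite twist0 mul1r !add0r.
- by rewrite mulr0 !addr0.
- by rewrite !addNr.
- by rewrite mulrN mulrA twistVr mul1r !subrr.
Qed.

Lemma add_dot_bi_skew_brace : bi_skew_brace add dot.
Proof.
have gA := add_is_group; have gD := dot_is_group.
split; split=> // -[a s] [c t] [d u]; rewrite !dotE ?dotV /=; congr pair.
- have -> : s + t + - s = t by ring.
  have -> : twist (s + t) * - (twist (- s) * a)
          = - (twist s * twist (- s)) * (twist t * a) by rewrite twistD; ring.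
  by rewrite twistVr; ring.
- by ring.
- by ring.
- by ring.
Qed.

(** Every [u] is a natural multiple of 1, so additive subgroups of ['Z_m] are ideals. *)
Lemma mulr_in_group (A : {group 'Z_m}) (u a : 'Z_m) : a \in A -> u * a \in A.
Proof. by move=> aA; rewrite -[u]natr_Zp mulr_natl -FinRing.zmodXgE groupX. Qed.

Lemma addr_in_group k (A : {group 'Z_k}) (a c : 'Z_k) :
  a \in A -> c \in A -> a + c \in A.
Proof. exact: groupM. Qed.

Lemma oppr_in_group k (A : {group 'Z_k}) (a : 'Z_k) : (- a \in A) = (a \in A).
Proof. exact: groupV. Qed.

(** Here [brace_act] at (c, t) sends (a, s) to (twist t * a, s). By the Chinese remainder theorem
    this is a natural multiple of (a, s), so it stays in every subgroup. *)
Lemma stable_dot_add (A : {set zprod m n}) : coprime m n ->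
  stable_subgroup dot add A = subgroup add A.
Proof.
move=> co; have [_ sb] := add_dot_bi_skew_brace.
apply/(stable_subgroupP sb)/idP => [[]//|sA]; split=> // -[c t] [a s] xA.
have /subgroupP[A1 AM _] := sA.
have natA k (x : zprod m n) : x \in A -> (x.1 *+ k, x.2 *+ k) \in A.
  move=> {}xA; elim: k => [|k IHk]; first by rewrite !mulr0n.
  by rewrite !mulrS; apply: (AM x (_, _)).
pose k := chinese m n (twist t) 1.
have -> : brace_act dot add (c, t) (a, s) = (a *+ k, s *+ k); last exact: natA (xA).
rewrite /brace_act dotE /=; congr pair.
  rewrite -mulr_natl addrAC subrr add0r; congr (_ * _).
  rewrite -[LHS]natr_Zp -[RHS](Zp_nat_mod m_gt1) chinese_modl //.
  by rewrite Zp_nat_mod.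
rewrite addrAC subrr add0r -mulr_natl -[k%:R](Zp_nat_mod n_gt1) chinese_modr //.
by rewrite Zp_nat_mod // mul1r.
Qed.

Lemma add_law_isog : coprime m n -> law_isog add 'Z_(m * n).
Proof.
move=> co; have mn_gt1 : (1 < m * n)%N by rewrite (ltn_trans m_gt1) // ltn_Pmulr // ltnW.
pose f (z : 'Z_(m * n)) : zprod m n := ((z : nat)%:R, (z : nat)%:R).
have f_inj : injective f.
  move=> y z [/(congr1 val) e1 /(congr1 val) e2].
  apply: val_inj; move: e1 e2; rewrite /= !val_Zp_nat // => e1 e2.
  have lt_mn (w : 'Z_(m * n)) : (w < m * n)%N.
    by have := ltn_ord w; rewrite [X in (_ < X)%N]Zp_cast.
  apply/eqP; rewrite -(modn_small (lt_mn y)) -(modn_small (lt_mn z)).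
  by rewrite chinese_remainder // e1 e2 !eqxx.
have [f' fK f'K] : bijective f.
  apply: inj_card_bij => //.
  by rewrite card_prod !card_ord !Zp_cast.
exists f'; split=> [|x y]; first by exists f.
rewrite -[x]f'K -[y]f'K; set u := f' x; set v := f' y; rewrite !fK.
apply: (can_inj fK); rewrite f'K FinRing.zmodMgE /f.
have -> : (u + v : 'Z_(m * n)) = ((u + v)%N %% (m * n))%N :> nat.
  by rewrite /= [X in (_ %% X)%N = _]Zp_cast.
congr pair; rewrite -natrD.
  rewrite -[LHS](Zp_nat_mod m_gt1) -[RHS](Zp_nat_mod m_gt1).
  by rewrite modn_dvdm ?dvdn_mulr.
rewrite -[LHS](Zp_nat_mod n_gt1) -[RHS](Zp_nat_mod n_gt1).
by rewrite modn_dvdm ?dvdn_mull.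
Qed.

Lemma cyclic_Zp k : cyclic [set: 'Z_k].
Proof. by rewrite Zp_cycle cycle_cyclic. Qed.

Lemma card_group_Zp k : (1 < k)%N -> #|{group 'Z_k}| = size (divisors k).
Proof.
by move=> k1; rewrite card_group_cyclic ?cyclic_Zp // card_ord Zp_cast.
Qed.

Lemma card_subgroup_add : coprime m n ->
  #|[set A : {set zprod m n} | subgroup add A]| = size (divisors (m * n)).
Proof.
move=> co; rewrite (card_subgroup_isog add_is_group (add_law_isog co)).
by rewrite card_group_Zp // (ltn_trans m_gt1) // ltn_Pmulr // ltnW.
Qed.

(** * Stable and arbitrary subgroups of the semidirect product *)

Hypothesis unitb :
  forall s, (0 < s < n)%N -> 1 - (b%:~R : 'Z_m) ^+ s \is a GRing.unit.

Lemma unit_twist s : s != 0 -> 1 - twist s \is a GRing.unit.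
Proof.
move=> ns; apply: unitb; rewrite lt0n -[X in (_ < X)%N](Zp_cast n_gt1) ltn_ord.
by rewrite andbT.
Qed.

Definition dot_kernel (G : {set zprod m n}) : {set 'Z_m} :=
  [set r | ((r, 0) : zprod m n) \in G].

Definition dot_image (G : {set zprod m n}) : {set 'Z_n} :=
  [set x.2 | x : zprod m n in G].

Lemma dot_kernel_group G : subgroup dot G -> group_set (dot_kernel G).
Proof.
move=> /subgroupP[G1 GM _]; apply/group_setP; split=> [|x y]; rewrite !inE //.
move=> xG yG; have := GM _ _ xG yG.
by rewrite dotE /= twist0 mul1r addr0.
Qed.

Lemma dot_image_group G : subgroup dot G -> group_set (dot_image G).
Proof.
move=> /subgroupP[G1 GM _]; apply/group_setP; split.
  by apply/imsetP; exists (id_of dot).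
move=> _ _ /imsetP[x xG ->] /imsetP[y yG ->].
by apply/imsetP; exists (dot x y); rewrite ?GM.
Qed.

Lemma dot_kernelP (G : {set zprod m n}) r r' s : subgroup dot G ->
  ((r', s) : zprod m n) \in G ->
  (r - r' \in dot_kernel G) = (((r, s) : zprod m n) \in G).
Proof.
move=> /subgroupP[G1 GM GV] rs; rewrite inE; apply/idP/idP => h.
  have := GM _ _ h rs; rewrite dotE /= twist0 mul1r add0r.
  by rewrite subrK.
have := GM _ _ h (GV _ rs); rewrite dotE dotV /=.
by rewrite mulrN mulrA twistVr mul1r subrr.
Qed.

(** Here [brace_act] at [x] keeps the second coordinate [s] and shifts the first by
    [(1 - twist s) * x.1]. For nonzero [s] the factor is a unit, so all shifts occur and [G]
    contains the whole fibre over [s]. *)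
Lemma stable_add_dotP (G : {set zprod m n}) :
  reflect (exists2 p : {group 'Z_m} * {group 'Z_n},
             (p.2 == 1%G) || (p.1 == [set: 'Z_m]%G) & G = setX p.1 p.2)
          (stable_subgroup add dot G).
Proof.
have [sb _] := add_dot_bi_skew_brace.
have actE (x y : zprod m n) :
    brace_act add dot x y = (y.1 + (1 - twist y.2) * x.1, y.2).
  rewrite /brace_act dotE dotV /=; congr pair; last by rewrite addrAC subrr add0r.
  have -> : twist (x.2 + y.2) * - (twist (- x.2) * x.1)
          = - (twist x.2 * twist (- x.2)) * (twist y.2 * x.1) by rewrite twistD; ring.
  by rewrite twistVr; ring.
apply: (iffP (stable_subgroupP sb _)) => [[sG aG]|[[A K] AK ->]]; last rewrite /= in AK.
  exists (Group (dot_kernel_group sG), Group (dot_image_group sG)) => /=.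
    have [K1|] := boolP (dot_image G \subset [set 0]).
      apply/orP; left; apply/eqP/val_inj/eqP; rewrite /= eqEsubset K1 /=.
      by rewrite sub1set; have /group_setP[] := dot_image_group sG.
    case/subsetPn => _ /imsetP[[r s] xG ->]; rewrite inE /= => ns.
    apply/orP; right; apply/eqP/val_inj/setP => c; rewrite /= !inE.
    have := aG (c / (1 - twist s), 0) _ xG; rewrite actE /=.
    rewrite mulrC divrK ?unit_twist // => xG'.
    by have := dot_kernelP (r + c) sG xG; rewrite xG' addrAC subrr add0r inE.
  apply/setP => -[r s]; rewrite !inE /=; apply/idP/idP => [xG|].
    suff: ((r, 0) : zprod m n) \in G.
      by move=> ->; apply/imsetP; exists (r, s).
    have [s0|ns] := eqVneq s 0; first by rewrite -s0.
    (* The shift by [r] puts (r + r, s) in [G], and dividing it by (r, s) leaves (r, 0). *)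
    have := aG (r / (1 - twist s), 0) _ xG; rewrite actE /=.
    rewrite mulrC divrK ?unit_twist // => xG'.
    by have := dot_kernelP (r + r) sG xG; rewrite xG' addrK inE => ->.
  case/andP => rG /imsetP[[r' s'] xG /= es]; rewrite -{}es in xG.
  have [s0|ns] := eqVneq s 0; first by rewrite s0.
  have := aG ((r - r') / (1 - twist s), 0) _ xG; rewrite actE /=.
  by rewrite mulrC divrK ?unit_twist // addrC subrK.
split; first apply/subgroupP.
  split=> [|[a s] [c t]|[a s]]; rewrite ?dotE ?dotV !inE /=.
  - by rewrite !group1.
  - move=> /andP[aA sK] /andP[cA tK].
    by rewrite !addr_in_group // mulr_in_group.
  - by move=> /andP[aA sK]; rewrite !oppr_in_group mulr_in_group.
move=> x y; rewrite actE; case: y => a s; rewrite !inE /= => /andP[aA sK]; rewrite sK andbT.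
case/orP: AK => /eqP e; last by rewrite e inE.
by move: sK; rewrite e inE => /eqP ->; rewrite twist0 subrr mul0r addr0.
Qed.

(** The product of the whole of ['Z_m] with the trivial group belongs to both families of
    [stable_add_dotP]; it accounts for the 1, placed on the left to avoid truncated subtraction. *)
Lemma card_stable_add_dot :
  (#|[set G : {set zprod m n} | stable_subgroup add dot G]| + 1 =
   size (divisors m) + size (divisors n))%N.
Proof.
pose S := [set p : {group 'Z_m} * {group 'Z_n} |
             (p.2 == 1%G) || (p.1 == [set: 'Z_m]%G)].
have -> : [set G : {set zprod m n} | stable_subgroup add dot G]
        = (fun p : {group 'Z_m} * {group 'Z_n} => setX p.1 p.2) @: S.
  apply/setP => G; rewrite inE; apply/stable_add_dotP/imsetP => -[p pS ->].
    by exists p; rewrite ?inE.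
  by exists p; rewrite inE in pS.
rewrite card_imset => [|[A K] [A' K'] /= /setP e]; last first.
  congr pair; apply/val_inj/setP => z.
    by have := e (z, 0); rewrite !inE /= !group1 !andbT.
  by have := e (0, z); rewrite !inE /= !group1.
have -> : S = setX [set: {group 'Z_m}] [set 1%G] :|: setX [set [set: 'Z_m]%G] setT.
  by apply/setP => -[A K]; rewrite !inE /= andbT.
rewrite -!card_group_Zp // cardsU !cardsX !cards1 !cardsT muln1 mul1n.
have -> : setX [set: {group 'Z_m}] [set 1%G] :&: setX [set [set: 'Z_m]%G] setT
        = [set ([set: 'Z_m]%G, 1%G : {group 'Z_n})].
  by apply/setP => -[A K]; rewrite !inE /= andbT andbC xpair_eqE.
rewrite cards1 subnK // ltn_addr //.
by apply/card_gt0P; exists 1%G.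
Qed.

(* A subgroup G with image K in 'Z_n and kernel A in 'Z_m is the set of (r, s)
   with s in K and r - c (1 - twist s) in A: it is K twisted by a coboundary,
   whose constant c only matters modulo A, and not at all when K is trivial. *)
Definition twisted_subgroup (t : {group 'Z_n} * {group 'Z_m} * {set 'Z_m}) :
    {set zprod m n} :=
  [set x : zprod m n | (x.2 \in t.1.1) &&
     [exists c in t.2, x.1 - c * (1 - twist x.2) \in t.1.2]].

(** For trivial [K] all cosets give the same subgroup, so the coset is pinned to [A] to keep the
    parametrisation injective. *)
Definition twist_data : {set {group 'Z_n} * {group 'Z_m} * {set 'Z_m}} :=
  [set t : {group 'Z_n} * {group 'Z_m} * {set 'Z_m} |
     if t.1.1 == 1%G then t.2 == (t.1.2 : {set 'Z_m})
           else t.2 \in rcosets t.1.2 [set: 'Z_m]].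

Lemma twist_dataP K (A : {group 'Z_m}) C : (K, A, C) \in twist_data ->
  exists2 c, C = (A :* c)%g & K = 1%G -> c = 0.
Proof.
rewrite inE /=; case: eqP => [-> /eqP->|nK /rcosetsP[c _ ->]]; last by exists c.
by exists 0 => //; rewrite -FinRing.zmod1gE mulg1.
Qed.

(** Another representative [a + c] of the coset changes the tested element by a multiple of [a],
    which stays in the ideal [A]. *)
Lemma mem_twisted_subgroup K (A : {group 'Z_m}) c (x : zprod m n) :
  (x \in twisted_subgroup (K, A, (A :* c)%g)) =
  (x.2 \in K) && (x.1 - c * (1 - twist x.2) \in A).
Proof.
rewrite inE /=; congr (_ && _); apply/exists_inP/idP => [[d]|xA]; last first.
  by exists c => //; apply: rcoset_refl.
move=> /rcosetP[a aA ->] dA; rewrite FinRing.zmodMgE in dA.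
have -> : x.1 - c * (1 - twist x.2)
        = (x.1 - (a + c) * (1 - twist x.2)) + (1 - twist x.2) * a by ring.
by rewrite addr_in_group // mulr_in_group.
Qed.

Lemma twisted_subgroup_group K (A : {group 'Z_m}) c :
  subgroup dot (twisted_subgroup (K, A, (A :* c)%g)).
Proof.
apply/subgroupP; split=> [|x y|x]; rewrite !mem_twisted_subgroup ?dotE ?dotV /=.
- by rewrite twist0 subrr mulr0 subr0 !group1.
- move=> /andP[xK xA] /andP[yK yA]; rewrite addr_in_group //= twistD.
  have -> : x.1 + twist x.2 * y.1 - c * (1 - twist x.2 * twist y.2)
          = (x.1 - c * (1 - twist x.2))
            + twist x.2 * (y.1 - c * (1 - twist y.2)) by ring.
  by rewrite addr_in_group // mulr_in_group.
move=> /andP[xK xA]; rewrite oppr_in_group xK /=.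
have -> : - (twist (- x.2) * x.1) - c * (1 - twist (- x.2))
        = - (twist (- x.2) * (x.1 - c * (1 - twist x.2)))
          - c * (1 - twist x.2 * twist (- x.2)) by ring.
by rewrite twistVr subrr mulr0 subr0 oppr_in_group mulr_in_group.
Qed.

Lemma group_neq1P k (K : {group 'Z_k}) :
  K <> 1%G -> exists2 s, s \in K & s != 0.
Proof.
move=> nK; have /subsetPn[s sK ns] : ~~ (K \subset [set 0]).
  apply/negP => /subsetP h; apply: nK; apply/val_inj/setP => s /=.
  by apply/idP/set1P => [/h/set1P|->]; last exact: group1.
by exists s; rewrite // inE in ns *.
Qed.

(** The points [(c * (1 - twist s), s)] detect [K], and the fibre over 0 is [A]. Over a nonzero [s]
    in [K], [(c - c') * (1 - twist s)] falls in [A] and the unit cancels, so the cosets agree. *)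
Lemma twisted_subgroup_inj : {in twist_data &, injective twisted_subgroup}.
Proof.
move=> [[K A] C] [[K' A'] C'] /twist_dataP[c -> c0] /twist_dataP[c' -> c0'] /setP e.
have eK : K = K'.
  apply/val_inj/setP => s /=; apply/idP/idP => sK.
    have := e (c * (1 - twist s), s).
    by rewrite !mem_twisted_subgroup /= subrr group1 sK => /esym/andP[].
  have := e (c' * (1 - twist s), s).
  by rewrite !mem_twisted_subgroup /= subrr group1 sK => /andP[].
have eA : A = A'.
  apply/val_inj/setP => r; have := e (r, 0).
  by rewrite !mem_twisted_subgroup /= twist0 subrr !mulr0 !subr0 !group1.
rewrite -{}eK -{}eA in c0' e *; congr pair.
have [K1|/eqP/group_neq1P[s sK ns]] := eqVneq K 1%G; first by rewrite c0 ?c0'.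
have := e (c * (1 - twist s), s).
rewrite !mem_twisted_subgroup /= subrr group1 sK -mulrBl /= => /esym h.
apply/rcoset_eqP; rewrite mem_rcoset FinRing.zmodMgE FinRing.zmodVgE.
rewrite -[c - c'](mulrK (unit_twist ns)) mulrC.
exact: mulr_in_group.
Qed.

(** In substance, the first cohomology of [K] in ['Z_m] modulo [A] vanishes: [K] is abelian and any
    nonzero [s0] in it has [1 - twist s0] invertible. *)
Lemma subgroup_dotP (G : {set zprod m n}) :
  reflect (exists2 t, t \in twist_data & G = twisted_subgroup t)
          (subgroup dot G).
Proof.
apply: (iffP idP) => [sG|[[[K A] C] /twist_dataP[c -> _] ->]]; last first.
  exact: twisted_subgroup_group.
pose A := Group (dot_kernel_group sG); pose K := Group (dot_image_group sG).
have /subgroupP[G1 GM GV] := sG.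
suff [c [cK GA]] : exists c, (K = 1%G -> c = 0) /\
    forall x, x \in G -> x.1 - c * (1 - twist x.2) \in A.
  exists (K, A, (A :* c)%g).
    rewrite inE /=; case: eqP => [/cK->|_]; last first.
      by apply/rcosetsP; exists c; rewrite ?inE.
    by rewrite -FinRing.zmod1gE mulg1.
  apply/setP => -[r s]; rewrite mem_twisted_subgroup /=; apply/idP/andP.
    by move=> xG; rewrite (GA (r, s)) //; split=> //; apply/imsetP; exists (r, s).
  case=> /imsetP[[r' s'] xG /= es] rA; rewrite -{}es in xG.
  rewrite -(dot_kernelP r sG xG).
  have -> : r - r' = (r - c * (1 - twist s)) - (r' - c * (1 - twist s)) by ring.
  by apply: addr_in_group (A) _ _ rA _; rewrite oppr_in_group; apply: (GA (r', s)).
have [K1|/eqP/group_neq1P[_ /imsetP[[r0 s0] yG ->] /= ns]] := eqVneq K 1%G.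
  exists 0; split=> // -[r s] xG; rewrite mul0r subr0 inE /=.
  have /set1P s1 : s \in (1%G : {group 'Z_n}).
    by rewrite -K1; apply/imsetP; exists (r, s).
  by rewrite s1 in xG.
(* The constant is forced by the point (r0, s0), where [r0 = c * (1 - twist s0)]. *)
exists (r0 / (1 - twist s0)); split=> [K1|[r s] xG /=].
  have /set1P s1 : s0 \in (1%G : {group 'Z_n}).
    by rewrite -K1; apply/imsetP; exists (r0, s0).
  by rewrite s1 eqxx in ns.
(* The products of (r0, s0) and (r, s) in the two orders have the same second coordinate, so their
   first coordinates differ by an element of the kernel [A]. *)
have := GM _ _ yG xG; rewrite dotE /= => yxG.
have := GM _ _ xG yG; rewrite dotE /= [s + s0]addrC -(dot_kernelP _ sG yxG).
have -> : r + twist s * r0 - (r0 + twist s0 * r)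
        = (1 - twist s0) * r - (1 - twist s) * r0 by ring.
move=> /(@mulr_in_group A (1 - twist s0)^-1); rewrite mulrBr mulKr ?unit_twist //.
by rewrite [_^-1 * _]mulrC [(1 - twist s) * r0]mulrC mulrAC.
Qed.

Lemma card_subgroup_dot :
  (#|[set G : {set zprod m n} | subgroup dot G]| =
   size (divisors m) + (size (divisors n)).-1 * sigma m)%N.
Proof.
have -> : [set G : {set zprod m n} | subgroup dot G]
        = twisted_subgroup @: twist_data.
  by apply/setP => G; rewrite inE; apply/subgroup_dotP/imsetP.
rewrite (card_in_imset twisted_subgroup_inj).
transitivity (\sum_(K : {group 'Z_n}) \sum_(A : {group 'Z_m})
    (if K == 1%G then 1 else #|[set: 'Z_m] : A|%g))%N.
  rewrite pair_big -sum1_card.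
  transitivity (\sum_(p : {group 'Z_n} * {group 'Z_m})
     \sum_(C | (p, C) \in twist_data) 1)%N.
    by rewrite pair_big_dep; apply: eq_big => // -[p C].
  apply: eq_bigr => -[K A] _ /=; rewrite sum1_card.
  case: ifPn => K1; last first.
    rewrite /indexg; apply: eq_card => C.
    by rewrite -[LHS]/((K, A, C) \in twist_data) inE /= (negPf K1).
  apply: etrans (cards1 (A : {set 'Z_m})); apply: eq_card => C.
  by rewrite -[LHS]/((K, A, C) \in twist_data) !inE /= K1.
(* The trivial [K] contributes one subgroup for each [A]; every other [K] contributes the sum of the
   indices of all [A], which is the sum of the divisors of [m]. *)
rewrite (bigD1 1%G) //= eqxx sum_nat_const muln1 card_group_Zp //; congr addn.
under eq_bigr => K /negPf nK do rewrite nK.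
rewrite sum_nat_const (sum_index_cyclic (fun d => d)) ?cyclic_Zp //.
rewrite card_ord; congr (_ * _)%N; last by rewrite Zp_cast.
by rewrite -card_group_Zp // -(cardC1 (1%G : {group 'Z_n})); apply: eq_card.
Qed.

End SemidirectLaw.

(** * Galois correspondence ratios for squarefree moduli *)

Lemma prod_primes_dvd (s : seq nat) k : all prime s -> uniq s ->
  (forall p, p \in s -> p %| k)%N -> (\prod_(p <- s) p %| k)%N.
Proof.
elim: s => [|p s IHs] /=; first by rewrite big_nil dvd1n.
move=> /andP[pp ps] /andP[ns us] h; rewrite big_cons Gauss_dvd.
  by rewrite h ?mem_head // IHs // => q qs; rewrite h // inE qs orbT.
by rewrite prime_coprime // prime_dvd_prod.
Qed.

Lemma prod_primes_coprime (s : seq nat) k : all prime s ->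
  (forall p, p \in s -> ~~ (p %| k))%N -> coprime (\prod_(p <- s) p) k.
Proof.
elim: s => [|p s IHs] /=; first by rewrite big_nil coprime1n.
move=> /andP[pp ps] h; rewrite big_cons coprimeMl prime_coprime //.
by rewrite h ?mem_head // IHs // => q qs; rewrite h // inE qs orbT.
Qed.

Lemma prod_primes_gt1 (s : seq nat) : all prime s -> (0 < size s)%N ->
  (1 < \prod_(p <- s) p)%N.
Proof.
case: s => //= p s /andP[pp ps] _; rewrite big_cons.
by rewrite (leq_trans (prime_gt1 pp)) // leq_pmulr // prod_primes_gt0.
Qed.

Lemma intr_abs_cases (R : nzRingType) (z : int) :
  z%:~R = `|z|%:R :> R \/ z%:~R = - `|z|%:R :> R.
Proof. by case: z => k; [left | right]; rewrite // NegzE rmorphN /= abszN. Qed.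

Lemma intr_Fp_eq0 p (z : int) : prime p ->
  ((z%:~R : 'F_p) == 0) = (p %| `|z|)%N.
Proof.
move=> pp; rewrite (dvdn_pcharf (pchar_Fp pp)).
by case: (intr_abs_cases 'F_p z) => ->; rewrite ?oppr_eq0.
Qed.

Section SquarefreeModulus.
Variables (s t : seq nat) (m n : nat) (b : int).
Hypotheses (s_prime : all prime s) (s_uniq : uniq s) (s_gt0 : (0 < size s)%N).
Hypotheses (t_prime : all prime t) (t_uniq : uniq t) (t_gt0 : (0 < size t)%N).
Hypotheses (def_m : m = (\prod_(p <- s) p)%N) (def_n : n = (\prod_(q <- t) q)%N).
Hypothesis (m_n_coprime : coprime m n).
Hypothesis (s_gt2 : forall p, p \in s -> (2 < p)%N).
Hypothesis b_prim : forall p, p \in s -> n.-primitive_root (b%:~R : 'F_p).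

Local Notation add := (add_law m n).
Local Notation dot := (semidirect_law m n b).

Lemma modulus_gt1 : (1 < m)%N.
Proof. by rewrite def_m prod_primes_gt1. Qed.

Lemma order_gt1 : (1 < n)%N.
Proof. by rewrite def_n prod_primes_gt1. Qed.

Lemma size_divisors_modulus : size (divisors m) = (2 ^ size s)%N.
Proof. by rewrite def_m size_divisors_prod. Qed.

Lemma size_divisors_order : size (divisors n) = (2 ^ size t)%N.
Proof. by rewrite def_n size_divisors_prod. Qed.

(** The modulus is a product of distinct primes, so divisibility by it can be tested at each of
    them. *)
Lemma intr_Zm_eq0 (z : int) :
  (forall p, p \in s -> (z%:~R : 'F_p) = 0) -> (z%:~R : 'Z_m) = 0.
Proof.
move=> h; suff e : (`|z|%:R : 'Z_m) = 0.
  by case: (intr_abs_cases 'Z_m z) => ->; rewrite e ?oppr0.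
apply/val_inj; rewrite /= val_Zp_nat ?modulus_gt1 //; apply/eqP.
rewrite -/(dvdn m _) def_m; apply: prod_primes_dvd => // p ps.
by rewrite -intr_Fp_eq0 ?(allP s_prime) // h.
Qed.

Lemma intr_Zm_unit (z : int) :
  (forall p, p \in s -> (z%:~R : 'F_p) != 0) -> (z%:~R : 'Z_m) \is a GRing.unit.
Proof.
move=> h; suff e : (`|z|%:R : 'Z_m) \is a GRing.unit.
  by case: (intr_abs_cases 'Z_m z) => ->; rewrite ?unitrN.
rewrite unitZpE ?modulus_gt1 // def_m; apply: prod_primes_coprime => // p ps.
by rewrite -intr_Fp_eq0 ?(allP s_prime) // h.
Qed.

Lemma expb_order : (b%:~R : 'Z_m) ^+ n = 1.
Proof.
apply/eqP; rewrite -subr_eq0 -rmorphXn -[1](rmorph1 intr) -rmorphB /=.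
apply/eqP/intr_Zm_eq0 => p ps.
by rewrite rmorphB rmorphXn rmorph1 /= (prim_expr_order (b_prim ps)) subrr.
Qed.

(** Since [b] has order exactly [n] modulo every prime factor, [1 - b ^ k] vanishes modulo none of
    them. *)
Lemma expb_unit k : (0 < k < n)%N ->
  1 - (b%:~R : 'Z_m) ^+ k \is a GRing.unit.
Proof.
case/andP=> k0 kn; rewrite -rmorphXn -[1](rmorph1 intr) -rmorphB /=.
apply: intr_Zm_unit => p ps; rewrite rmorphB rmorphXn rmorph1 /= subr_eq0 eq_sym.
by rewrite -(prim_order_dvd (b_prim ps)) gtnNdvd.
Qed.

Lemma squarefree_bi_skew_brace : bi_skew_brace add dot.
Proof. exact: add_dot_bi_skew_brace order_gt1 expb_order. Qed.

Lemma card_subgroup_add_squarefree :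
  #|[set A : {set zprod m n} | subgroup add A]| = (2 ^ (size t + size s))%N.
Proof.
rewrite card_subgroup_add ?modulus_gt1 ?order_gt1 // def_m def_n.
rewrite -big_cat size_divisors_prod ?size_cat 1?addnC // ?all_cat ?s_prime //.
rewrite cat_uniq s_uniq t_uniq andbT; apply/hasPn => q qt; apply/negP => qs.
have := m_n_coprime; rewrite /coprime => /eqP g1.
have : (q %| gcdn m n)%N by rewrite dvdn_gcd def_m def_n !prime_dvd_prod
  ?(allP t_prime q) ?qs.
by rewrite g1 dvdn1 => /eqP q1; have := allP t_prime q qt; rewrite q1.
Qed.

Lemma stable_ratio_add_dot : stable_ratio add dot
  = (2 ^+ size t + 2 ^+ size s - 1) / 2 ^+ (size t + size s).
Proof.
rewrite /stable_ratio card_subgroup_add_squarefree natrX; congr (_ / _).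
have /(congr1 (fun k => k%:R : rat)) := card_stable_add_dot modulus_gt1 order_gt1
  expb_order expb_unit.
rewrite size_divisors_modulus size_divisors_order !natrD !natrX.
by move=> e; rewrite [2 ^+ _ + _]addrC -e addrK.
Qed.

Lemma stable_ratio_dot_add : stable_ratio dot add
  = 2 ^+ (size t + size s)
    / (2 ^+ size s + (2 ^+ size t - 1) * (sigma m)%:R).
Proof.
rewrite /stable_ratio; congr (_ / _).
  rewrite -natrX -card_subgroup_add_squarefree; congr (_%:R).
  apply: eq_card => A; rewrite !inE.
  by rewrite (stable_dot_add modulus_gt1 order_gt1 expb_order).
rewrite (card_subgroup_dot modulus_gt1 order_gt1 expb_order expb_unit).
rewrite size_divisors_modulus size_divisors_order natrD natrM -subn1.
by rewrite natrB ?expn_gt0 // !natrX.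
Qed.

Lemma sigma_ge : (3 ^ size s <= sigma m)%N.
Proof.
rewrite def_m sigma_prod //; elim: s s_gt2 => [|p r IHr] h; first by rewrite big_nil.
rewrite big_cons expnS leq_mul //=.
  by rewrite (leq_trans (h p (mem_head _ _))) // leq_addl.
by apply: IHr => q qr; apply: h; rewrite inE qr orbT.
Qed.

(** With [H = 2 ^+ size t], at least 2, one has [H <= 2 * (H - 1)]; together with [sigma_ge] this
    makes the denominator at least half of [H * 3 ^+ size s]. *)
Lemma stable_ratio_dot_add_le : stable_ratio dot add <= 2 * (2 / 3) ^+ size s.
Proof.
have H2 : 2 <= 2 ^+ size t :> rat.
  by rewrite -[X in X <= _]expr1 ler_weXn2l.
have sg : 3 ^+ size s <= (sigma m)%:R :> rat by rewrite -natrX ler_nat sigma_ge.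
have a0 : 0 < 2 ^+ size s :> rat by rewrite exprn_gt0.
have c0 : 0 < 3 ^+ size s :> rat by rewrite exprn_gt0.
rewrite stable_ratio_dot_add expr_div_n exprD.
move: (2 ^+ size t) (2 ^+ size s) (3 ^+ size s) ((sigma m)%:R : rat) H2 sg a0 c0.
move=> H a c S H2 sg a0 c0.
have d0 : 0 < a + (H - 1) * S by nra.
rewrite ler_pdivrMr //.
have -> : 2 * (a / c) * (a + (H - 1) * S) = 2 * a * (a + (H - 1) * S) / c by ring.
rewrite ler_pdivlMr //.
have h1 : (H - 1) * c <= (H - 1) * S by rewrite ler_pM2l //; lra.
have h2 : H * c <= 2 * (a + (H - 1) * S) by nra.
by rewrite [H * a]mulrC -!mulrA [2 * (a * _)]mulrCA ler_pM2l.
Qed.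

Lemma squarefree_GC :
  (forall (F : fieldType) (L : splittingFieldType F) (i : zprod m n -> gal_of {:L}),
     galois_with add i -> GC add dot i = stable_ratio add dot) /\
  (forall (F : fieldType) (L : splittingFieldType F) (i : zprod m n -> gal_of {:L}),
     galois_with dot i -> GC dot add i = stable_ratio dot add).
Proof.
by have [sb1 sb2] := squarefree_bi_skew_brace;
  split=> F L i; apply: GC_stable_ratio.
Qed.

End SquarefreeModulus.

(** * The dihedral case *)

(** The map sending (r, s) to [x ^+ r * y ^+ s] is a morphism because [y] inverts [x]. It is onto,
    as the dihedral group is the product of the two cyclic groups, and both sides have [2 * m]
    elements. *)
Lemma dot_law_isog_dihedral m (b : int) : (1 < m)%N ->
  (b%:~R : 'Z_m) = -1 -> law_isog (semidirect_law m 2 b) 'D_(2 * m).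
Proof.
move=> m_gt1 b_m1; rewrite mul2n.
have /existsP[[x y] /= /eqP[defD xm y2 xy]] := isoGrp_hom (Grp_dihedral m_gt1).
have ox : (#[x]%g %| m)%N by rewrite order_dvdn xm.
have xD (i j : 'Z_m) : (x ^+ (i + j)%R = x ^+ i * x ^+ j)%g.
  by rewrite expgD_Zp // ltnW.
have xN (i : 'Z_m) : (x ^+ (- i)%R = x ^- i)%g.
  by apply: (mulgI (x ^+ i)%g); rewrite -xD subrr mulgV.
have yD (i j : 'Z_2) : (y ^+ (i + j)%R = y ^+ i * y ^+ j)%g.
  by rewrite expgD_Zp // order_dvdn y2.
pose f (z : zprod m 2) := (x ^+ z.1 * y ^+ z.2)%g.
have fM u v : f (semidirect_law m 2 b u v) = (f u * f v)%g.
  rewrite -[f (_ u v)]/(x ^+ (u.1 + b%:~R ^+ u.2 * v.1)%R * y ^+ (u.2 + v.2)%R)%g.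
  rewrite /f xD yD b_m1; have [->|->] : u.2 = 0 \/ u.2 = 1.
    by case: (u.2) => -[|[|//]] lt2; [left | right]; apply: val_inj.
  - by rewrite expr0 mul1r !expg0 !mulg1 mul1g mulgA.
  rewrite expr1 mulN1r xN !expg1 !mulgA; congr (_ * _)%g; rewrite -!mulgA.
  congr (_ * _)%g; have -> : (y * x ^+ v.1 = (x ^+ v.1) ^ y^-1 * y)%g.
    by rewrite conjgE invgK !mulgA mulgKV.
  have yV : (y^-1 = y)%g.
    by apply: (mulgI y); rewrite mulgV -y2 expgS expg1.
  by rewrite yV conjXg xy expgVn.
have f_surj z : exists u, f u = z.
  have : z \in (<[x]> * <[y]>)%g.
    rewrite -norm_joinEr ?defD ?inE // cycle_subG.
    by apply/normP; rewrite -cycleJ xy cycleV.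
  case/mulsgP=> _ _ /cycleP[i ->] /cycleP[j ->] ->.
  exists (i%:R, j%:R); rewrite /f /= !val_Zp_nat //.
  by rewrite (expg_mod i xm) (expg_mod j y2).
exists f; split=> //; apply: inj_card_bij; last first.
  by rewrite -[#|_|]cardsT card_dihedral // card_prod !card_ord !Zp_cast // muln2.
have f_im : f @: [set: zprod m 2] = [set: 'D_m.*2].
  by apply/setP => z; rewrite inE; apply/imsetP; have [u <-] := f_surj z; exists u.
have /imset_injP h : #|f @: [set: zprod m 2]| == #|[set: zprod m 2]|.
  by rewrite f_im card_dihedral // cardsT card_prod !card_ord !Zp_cast // muln2.
by move=> u v; apply: h; rewrite inE.
Qed.

Lemma squarefree_prod_primes m : (0 < m)%N -> squarefree m ->
  (\prod_(p <- primes m) p)%N = m.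
Proof.
move=> m0 sq; rewrite [RHS]prod_prime_decomp // prime_decompE big_map.
apply: eq_big_seq => p; rewrite mem_primes => /and3P[pp _ pm] /=.
suff -> : logn p m = 1%N by rewrite expn1.
apply/eqP; rewrite eqn_leq logn_gt0 mem_primes pp m0 pm /= andbT leqNgt.
apply/negP; rewrite -pfactor_dvdn // expnS expn1 => ppm.
by rewrite (sq p ppm) in pp.
Qed.

(** An explicit rate for the limit. The inductive step is [(2 / 3) * (g + 3) <= g + 2], and the
    shift by 2 makes it hold from [g = 0] on. *)
Lemma expr23_le g : (2 / 3) ^+ g * (g%:R + 2) <= 2 :> rat.
Proof.
elim: g => [|g IHg]; first by rewrite expr0; lra.
apply: le_trans IHg; rewrite exprS -[g.+1]addn1 natrD.
have : 0 <= (2 / 3) ^+ g :> rat by rewrite exprn_ge0.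
have : 0 <= g%:R :> rat by rewrite ler0n.
move: ((2 / 3) ^+ g) (g%:R : rat) => a c c0 a0; nra.
Qed.

Lemma dihedral_galois_ratios :
  forall (g m : nat) (b : int),
     (1 <= g)%N -> odd m -> squarefree m -> size (primes m) = g ->
     (forall p, p \in primes m -> 2.-primitive_root (b%:~R : 'F_p)) ->
     let add := add_law m 2 in
     let dot := semidirect_law m 2 b in
     [/\ bi_skew_brace add dot,
         law_isog dot 'D_(2 * m),
         law_isog add 'Z_(2 * m),
         [/\ (forall (F : fieldType) (L : splittingFieldType F)
                     (i : zprod m 2 -> gal_of {:L}),
                galois_with add i -> GC add dot i = stable_ratio add dot),
             stable_ratio add dot = (2 ^+ g + 1) / 2 ^+ (g + 1) &
             stable_ratio add dot > 1 / 2] &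
         [/\ (forall (F : fieldType) (L : splittingFieldType F)
                     (i : zprod m 2 -> gal_of {:L}),
                galois_with dot i -> GC dot add i = stable_ratio dot add) &
             stable_ratio dot add <= 2 * (2 / 3) ^+ g]].
Proof.
move=> g m b g_gt0 m_odd m_sq size_m b_prim add dot.
have m0 : (0 < m)%N by case: (m) m_odd.
pose s := primes m; pose t : seq nat := [:: 2%N].
have ps : all prime s by apply/allP => p; rewrite mem_primes => /and3P[].
have us : uniq s := primes_uniq m.
have s0 : (0 < size s)%N by rewrite size_m.
have dm : m = (\prod_(p <- s) p)%N by rewrite squarefree_prod_primes.
have dn : 2%N = (\prod_(p <- t) p)%N by rewrite big_seq1.
have co : coprime m 2 by rewrite coprimen2.
have s2 p : p \in s -> (2 < p)%N.
  move=> sp; have pp := allP ps p sp; rewrite ltn_neqAle prime_gt1 // andbT.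
  apply: contraTneq sp => <-; rewrite mem_primes m0 /=.
  by rewrite dvdn2 m_odd.
have m1 := modulus_gt1 ps s0 dm.
have e1 := stable_ratio_add_dot ps us s0 (isT : all prime t) isT isT dm dn co b_prim.
have e2 := stable_ratio_dot_add_le ps us s0 (isT : all prime t) isT isT dm dn co
  s2 b_prim.
have [GC1 GC2] := squarefree_GC ps us s0 (isT : all prime t) isT dm dn b_prim.
(* One has [(1 - b) * (1 + b) = 1 - b ^ 2 = 0] modulo [m], and [1 - b] is a unit. *)
have b_m1 : (b%:~R : 'Z_m) = -1.
  apply/eqP; rewrite -addr_eq0 addrC.
  rewrite -(mulrI_eq0 _ (mulrI (expb_unit ps s0 dm b_prim (isT : (0 < 1 < 2)%N)))).
  by rewrite expr1 -subr_sqr expr1n (expb_order ps us s0 dm b_prim) subrr.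
rewrite size_m in e1 e2; split.
- exact: squarefree_bi_skew_brace ps us s0 (isT : all prime t) isT dm dn b_prim.
- exact: dot_law_isog_dihedral.
- by rewrite mulnC; apply: add_law_isog.
- have e : stable_ratio add dot = (2 ^+ g + 1) / 2 ^+ (g + 1).
    by rewrite e1 addnC; congr (_ / _); rewrite expr1; ring.
  split=> //; rewrite e ltr_pdivlMr ?exprn_gt0 // exprD expr1.
  by rewrite mulrCA mulfV // mulr1 ltrDl.
- by [].
Qed.

Theorem mainTheorem1 :
  (forall (g h : nat) (p : 'I_g -> nat) (q : 'I_h -> nat) (b : int),
     (1 <= g)%N -> (1 <= h)%N ->
     injective p -> (forall i, prime (p i)) ->
     injective q -> (forall j, prime (q j)) ->
     (forall j i, (q j %| (p i).-1)%N) ->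
     (forall i, (\prod_(j < h) q j)%N.-primitive_root (b%:~R : 'F_(p i))) ->
     let m := (\prod_(i < g) p i)%N in
     let n := (\prod_(j < h) q j)%N in
     let add := add_law m n in
     let dot := semidirect_law m n b in
     [/\ bi_skew_brace add dot,
         law_isog add 'Z_(m * n),
         [/\ (forall (F : fieldType) (L : splittingFieldType F)
                     (i : zprod m n -> gal_of {:L}),
                galois_with add i -> GC add dot i = stable_ratio add dot) &
             stable_ratio add dot = (2 ^+ h + 2 ^+ g - 1) / 2 ^+ (h + g)] &
         [/\ (forall (F : fieldType) (L : splittingFieldType F)
                     (i : zprod m n -> gal_of {:L}),
                galois_with dot i -> GC dot add i = stable_ratio dot add),
             sigma m = (\prod_(i < g) (1 + p i))%N,
             stable_ratio dot add
               = 2 ^+ (h + g) / (2 ^+ g + (2 ^+ h - 1) * (sigma m)%:R) &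
             stable_ratio dot add <= 2 * (2 / 3) ^+ g]])
  /\
  (forall (g m : nat) (b : int),
     (1 <= g)%N -> odd m -> squarefree m -> size (primes m) = g ->
     (forall p, p \in primes m -> 2.-primitive_root (b%:~R : 'F_p)) ->
     let add := add_law m 2 in
     let dot := semidirect_law m 2 b in
     [/\ bi_skew_brace add dot,
         law_isog dot 'D_(2 * m),
         law_isog add 'Z_(2 * m),
         [/\ (forall (F : fieldType) (L : splittingFieldType F)
                     (i : zprod m 2 -> gal_of {:L}),
                galois_with add i -> GC add dot i = stable_ratio add dot),
             stable_ratio add dot = (2 ^+ g + 1) / 2 ^+ (g + 1) &
             stable_ratio add dot > 1 / 2] &
         [/\ (forall (F : fieldType) (L : splittingFieldType F)
                     (i : zprod m 2 -> gal_of {:L}),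
                galois_with dot i -> GC dot add i = stable_ratio dot add) &
             stable_ratio dot add <= 2 * (2 / 3) ^+ g]])
  /\
  (forall eps : rat, 0 < eps ->
     exists g0 : nat, forall (g m : nat) (b : int),
       (g0 <= g)%N -> (1 <= g)%N -> odd m -> squarefree m ->
       size (primes m) = g ->
       (forall p, p \in primes m -> 2.-primitive_root (b%:~R : 'F_p)) ->
       let add := add_law m 2 in
       let dot := semidirect_law m 2 b in
       `|stable_ratio dot add| < eps /\
       (forall (F : fieldType) (L : splittingFieldType F)
               (i : zprod m 2 -> gal_of {:L}),
          galois_with dot i -> `|GC dot add i| < eps)).
Proof.
split; [|split].
- move=> g h p q b g0 h0 p_inj p_pr q_inj q_pr q_dvd b_prim m n add dot.
  pose s := [seq p i | i : 'I_g]; pose t := [seq q j | j : 'I_h].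
  have sg : size s = g by rewrite size_map size_enum_ord.
  have st : size t = h by rewrite size_map size_enum_ord.
  have ps : all prime s by apply/allP => _ /mapP[i _ ->].
  have pt : all prime t by apply/allP => _ /mapP[i _ ->].
  have us : uniq s by rewrite map_inj_uniq ?enum_uniq.
  have ut : uniq t by rewrite map_inj_uniq ?enum_uniq.
  have dm : m = (\prod_(p <- s) p)%N by rewrite big_map big_enum.
  have dn : n = (\prod_(p <- t) p)%N by rewrite big_map big_enum.
  have s0 : (0 < size s)%N by rewrite sg.
  have t0 : (0 < size t)%N by rewrite st.
  (* Dividing [p i - 1] makes each [q j] smaller than each [p i]. Hence no prime is shared by [m]
     and [n], and each [p i] exceeds 2, being larger than the prime [q] of index 0. *)
  have lt_qp j i : (q j < p i)%N.
    rewrite -[p i]prednK ?prime_gt0 // ltnS dvdn_leq ?q_dvd //.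
    by rewrite -subn1 subn_gt0 prime_gt1.
  have co : coprime m n.
    rewrite dm; apply: prod_primes_coprime => // _ /mapP[i _ ->].
    rewrite dn prime_dvd_prod //; apply/negP => /mapP[j _ e].
    by have := lt_qp j i; rewrite e ltnn.
  have s2 r : r \in s -> (2 < r)%N.
    case/mapP=> i _ ->; apply: leq_ltn_trans (lt_qp (Ordinal h0) i).
    exact: prime_gt1.
  have bp r : r \in s -> n.-primitive_root (b%:~R : 'F_r).
    by case/mapP=> i _ ->; apply: b_prim.
  have [GC1 GC2] := squarefree_GC ps us s0 pt t0 dm dn bp.
  have e1 := stable_ratio_add_dot ps us s0 pt ut t0 dm dn co bp.
  have e2 := stable_ratio_dot_add ps us s0 pt ut t0 dm dn co bp.
  have e3 := stable_ratio_dot_add_le ps us s0 pt ut t0 dm dn co s2 bp.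
  rewrite sg ?st in e1 e2 e3; split=> //.
  + exact: squarefree_bi_skew_brace ps us s0 pt t0 dm dn bp.
  + by apply: add_law_isog => //; [apply: modulus_gt1 dm | apply: modulus_gt1 dn].
  + by split=> //; rewrite dm sigma_prod // big_map big_enum.
- exact: dihedral_galois_ratios.
(* By [expr23_le] the bound [2 * (2 / 3) ^+ g] is at most [4 / (g + 2)], which is below [eps] once
   [g] exceeds [4 / eps]. *)
move=> eps eps0; exists (Num.bound (4 / eps)) => g m b g_ge g_gt0 m_odd m_sq size_m b_prim.
move=> add dot.
have [_ _ _ _ [GC_eq le_ratio]] := dihedral_galois_ratios g_gt0 m_odd m_sq size_m b_prim.
suff lt_eps : `|stable_ratio dot add| < eps.
  by split=> // F L i gi; rewrite GC_eq.
rewrite ger0_norm; last by rewrite divr_ge0 ?ler0n.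
apply: le_lt_trans le_ratio _.
have lt_g : 4 / eps < g%:R.
  apply: lt_le_trans (archi_boundP _) _; last by rewrite ler_nat.
  by rewrite divr_ge0 // ltW.
rewrite ltr_pdivrMr // in lt_g.
have := expr23_le g.
have : 0 <= (2 / 3) ^+ g :> rat by rewrite exprn_ge0.
move: ((2 / 3) ^+ g) (g%:R : rat) lt_g => a c lt_g a0 le2.
have c0 : 0 < c by rewrite -(pmulr_lgt0 _ eps0) (lt_trans _ lt_g).
rewrite -(ltr_pM2r c0) [eps * c]mulrC; apply: le_lt_trans lt_g.
by rewrite mulrAC -mulrA; nra.
Qed.
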